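(* Let $N$ be a manifold, either finite dimensional or a Banach manifold, with cotangent bundle $\pi\colon T^*N\to N$ and canonical $1$-form $\lambda$ on $T^*N$. Let $\sigma$ be a closed $2$-form on $N$. Then $\omega_\sigma:=d\lambda+\pi^*\sigma$ is a weak symplectic form on $T^*N$.
   Context: Elements of $T^*N$ are pairs $z=(q,p)$ with $q\in N$, $p\in T_q^*N$ (topological dual), and $\pi(q,p)=q$. The canonical $1$-form is $\lambda_z\zeta:=p(d\pi|_z\zeta)$ for $\zeta\in T_zT^*N$. The exterior derivative is the usual one, e.g. $d\lambda(X,Y)=d(\lambda Y)X-d(\lambda X)Y-\lambda[X,Y]$ for vector fields $X,Y$. A weak symplectic form is a closed $2$-form $\omega$ that is non-degenerate in the sense that for every nonzero tangent vector $\zeta$ there is a tangent vector $\nu$ at the same point with $\omega(\nu,\zeta)\neq0$ (no isomorphism between tangent and cotangent spaces is required). *)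

(* Defs.v *)
From HB Require Import structures.
From mathcomp Require Import all_boot all_order all_algebra.
From mathcomp Require Import all_classical all_reals all_analysis.
Set Implicit Arguments.
Unset Strict Implicit.
Unset Printing Implicit Defensive.
Import Order.TTheory GRing.Theory Num.Theory.
Import numFieldNormedType.Exports.
Local Open Scope classical_set_scope.
Local Open Scope ring_scope.

(* Makes R^n a Banach space, so that finite dimensional manifolds are
   manifolds modelled on a [completeNormedModType]. *)
HB.instance Definition _ (R : realType) (m n : nat) :=
  Uniform_isComplete.Build 'M[R]_(m, n) (@mx_complete R m n).

Section ContinuousLinear.
Context {R : realType} (E F : normedModType R).

Definition clinear_pred : {pred E -> F} :=
  [pred f : E -> F | `[< linear f /\ continuous f >]].

Lemma clinear_closed : submod_closed clinear_pred.
Proof.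
split.
  by apply/asboolP; split=> [a x y|x]; [rewrite scaler0 addr0|exact: cvg_cst].
move=> a f g /asboolP[lf cf] /asboolP[lg cg]; apply/asboolP; split.
  move=> k x y; change (a *: f (k *: x + y) + g (k *: x + y) =
    k *: (a *: f x + g x) + (a *: f y + g y)).
  by rewrite lf lg !scalerDr !scalerA (mulrC a) addrACA.
move=> x; apply: cvgD; last exact: cg.
by apply: cvgZr; exact: cf.
Qed.

HB.instance Definition _ :=
  GRing.isSubmodClosed.Build R (E -> F) clinear_pred clinear_closed.

(* L(E, F), normed below by the operator norm. *)
Record clinear := CLinear {
  clinear_fun :> E -> F;
  clinear_funP : clinear_fun \in clinear_pred }.

HB.instance Definition _ := [isSub for clinear_fun].
HB.instance Definition _ := [Choice of clinear by <:].
HB.instance Definition _ := [SubChoice_isSubLmodule of clinear by <:].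

Lemma clinear_linear (f : clinear) : linear f.
Proof. by have /asboolP[] := clinear_funP f. Qed.

Lemma clinear_continuous (f : clinear) : continuous f.
Proof. by have /asboolP[] := clinear_funP f. Qed.

HB.instance Definition _ (f : clinear) :=
  GRing.isLinear.Build R E F *:%R f (clinear_linear f).

Definition opnorm (f : clinear) : R :=
  sup [set `|f x| | x in [set x : E | `|x| <= 1]].

Lemma opnorm_has_sup (f : clinear) :
  has_sup [set `|f x| | x in [set x : E | `|x| <= 1]].
Proof.
split; first by exists `|f 0|, 0 => //=; rewrite normr0.
have /linear_bounded_continuous/bounded_funP := @clinear_continuous f.
by move=> /(_ 1)[M fM]; exists M => _ [x /= x1 <-]; exact: fM.
Qed.

Lemma le_opnorm (f : clinear) x : `|f x| <= opnorm f * `|x|.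
Proof.
have [->|x0] := eqVneq x 0; first by rewrite linear0 !normr0 mulr0.
rewrite -ler_pdivrMr ?normr_gt0//.
apply: sup_ubound; first exact: (opnorm_has_sup f).2.
exists (`|x|^-1 *: x) => /=.
  by rewrite normrZ normfV normr_id mulVf// normr_eq0.
by rewrite linearZ/= normrZ normfV normr_id mulrC.
Qed.

Lemma opnorm_le (f : clinear) M :
  (forall x, `|x| <= 1 -> `|f x| <= M) -> opnorm f <= M.
Proof.
move=> fM; apply: ge_sup; first exact: (opnorm_has_sup f).1.
by move=> _ [x /= x1 <-]; exact: fM.
Qed.

Lemma opnorm_ge0 (f : clinear) : 0 <= opnorm f.
Proof.
apply: sup_ubound; first exact: (opnorm_has_sup f).2.
by exists 0; rewrite /= ?normr0// linear0 normr0.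
Qed.

Lemma le_opnorm1 (f : clinear) x : `|x| <= 1 -> `|f x| <= opnorm f.
Proof.
by move=> x1; rewrite (le_trans (le_opnorm f x))// ler_piMr// opnorm_ge0.
Qed.

Lemma opnormD (f g : clinear) : opnorm (f + g) <= opnorm f + opnorm g.
Proof.
apply: opnorm_le => x x1; rewrite (le_trans (ler_normD (f x) (g x)))//.
by rewrite lerD// le_opnorm1.
Qed.

Lemma opnormZ (a : R) (f : clinear) : opnorm (a *: f) = `|a| * opnorm f.
Proof.
have le b (h : clinear) : opnorm (b *: h) <= `|b| * opnorm h.
  apply: opnorm_le => x x1; change (`|b *: h x| <= `|b| * opnorm h).
  by rewrite normrZ ler_wpM2l// le_opnorm1.
apply/eqP; rewrite eq_le le/=.
have [->|a0] := eqVneq a 0; first by rewrite normr0 mul0r opnorm_ge0.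
have := le a^-1 (a *: f); rewrite scalerA mulVf// scale1r normfV.
by rewrite ler_pdivlMl ?normr_gt0.
Qed.

Lemma opnorm_eq0 (f : clinear) : opnorm f = 0 -> f = 0.
Proof.
move=> f0; apply/val_inj/funext => x; apply/eqP; change (f x == 0).
by rewrite -normr_le0 (le_trans (le_opnorm f x))// f0 mul0r.
Qed.

HB.instance Definition _ :=
  Lmodule_isNormed.Build R clinear opnormD opnormZ opnorm_eq0.

End ContinuousLinear.

Notation dual E := (clinear E (_^o)).

Section Calculus.
Context {R : realType}.

Lemma clinear_comp_subproof (E F G : normedModType R)
    (g : clinear F G) (f : clinear E F) :
  (g \o f : E -> G) \in @clinear_pred R E G.
Proof.
apply/asboolP; split=> [a x y|x]; first by rewrite /= !linearP.
by apply: continuous_comp; exact: clinear_continuous.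
Qed.

Definition clinear_comp (E F G : normedModType R)
    (g : clinear F G) (f : clinear E F) : clinear E G :=
  CLinear (clinear_comp_subproof g f).

(* The Frechet differential as an element of L(E, F); the default value 0 is
   used only when ['d f x] is not continuous, hence f not differentiable. *)
Definition Diff (E F : normedModType R) (f : E -> F) (x : E) : clinear E F :=
  insubd 0 ('d f x : E -> F).

(* f is C^k on the open set U; f is a total function but only its values on U
   matter. *)
Fixpoint Ck_on (k : nat) (E F : normedModType R) (U : set E) (f : E -> F)
    : Prop :=
  match k with
  | 0 => forall x, U x -> {for x, continuous f}
  | k'.+1 => (forall x, U x -> differentiable f x) /\ Ck_on k' U (Diff f)
  end.

Definition smooth_on (E F : normedModType R) (U : set E) (f : E -> F) : Prop :=
  forall k, Ck_on k U f.

End Calculus.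

Section Manifolds.
Context {R : realType}.

(* A set with an indexed family of charts into E. The total functions [chart i]
   and [chart_inv i] are meaningful only on [chart_dom i] and on its image.
   [chart_at q] is a chart around q, used to represent tangent vectors at q. *)
Record charted_space (E : normedModType R) := ChartedSpace {
  carrier :> Type;
  chart_index : Type;
  chart_dom : chart_index -> set carrier;
  chart : chart_index -> carrier -> E;
  chart_inv : chart_index -> E -> carrier;
  chart_at : carrier -> chart_index }.

(* The charts form a C^oo atlas (on a set: the topology is the one for which
   the chart domains are open and the charts are homeomorphisms). *)
Definition smooth_manifold (E : normedModType R) (M : charted_space E) : Prop :=
  [/\ forall q : M, chart_dom (chart_at q) q,
      forall (i : chart_index M) q, chart_dom i q ->
        chart_inv i (chart i q) = q,
      forall i j : chart_index M,
        open (chart i @` (chart_dom i `&` chart_dom j)) &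
      forall i j : chart_index M,
        smooth_on (chart i @` (chart_dom i `&` chart_dom j))
                  (chart j \o chart_inv i)].

(* A tangent vector at q is a class of pairs (chart around q, vector of E)
   modulo the differentials of the transition maps; it is represented by its
   unique representative in the chart [chart_at q]. The norm of E then induces
   the topology of T_q M. *)
Definition tangent (E : normedModType R) (M : charted_space E) (q : M)
  : normedModType R := E.

Section Maps.
Context {E F : normedModType R} {M : charted_space E} {N : charted_space F}.

(* The differential T_q M -> T_(f q) N of a map between manifolds. *)
Definition mdiff (f : M -> N) (q : M) : clinear (tangent q) (tangent (f q)) :=
  Diff (chart (chart_at (f q)) \o f \o chart_inv (chart_at q))
       (chart (chart_at q) q).

End Maps.

Section Forms.
Context {E : normedModType R} (M : charted_space E).

Definition form1 := forall q : M, tangent q -> R.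
Definition form2 := forall q : M, tangent q -> tangent q -> R.
Definition form3 := forall q : M, tangent q -> tangent q -> tangent q -> R.

(* The vector at [chart_inv i x] whose expression in the chart i is v. *)
Definition chart_vector (i : chart_index M) (x v : E)
    : tangent (chart_inv i x) :=
  Diff (chart (chart_at (chart_inv i x)) \o chart_inv i) x v.

(* Local expressions of forms, i.e. their pull-backs by [chart_inv i]. *)
Definition local1 (a : form1) (i : chart_index M) (x u : E) : R :=
  a _ (chart_vector i x u).
Definition local2 (w : form2) (i : chart_index M) (x u v : E) : R :=
  w _ (chart_vector i x u) (chart_vector i x v).

(* Bilinearity and continuity of w at each point are part of the requirement
   that its local expressions take values in L(E, L(E, R)). *)
Definition is_2form (w : form2) : Prop :=
  (forall q (u : tangent q), w q u u = 0) /\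
  (forall i : chart_index M, exists B : E -> clinear E (dual E),
     smooth_on (chart i @` chart_dom i) B /\
     forall x, (chart i @` chart_dom i) x ->
       forall u v, local2 w i x u v = B x u v).

(* The exterior derivatives, computed in the chart [chart_at q] by the formula
   with vector fields that are constant in this chart (so that their brackets
   vanish). *)
Definition ext1 (a : form1) : form2 := fun q u v =>
  let i := chart_at q in let x := chart i q in
  'd (fun y => local1 a i y v : R^o) x u
  - 'd (fun y => local1 a i y u : R^o) x v.

Definition ext2 (w : form2) : form3 := fun q u v t =>
  let i := chart_at q in let x := chart i q in
  'd (fun y => local2 w i y v t : R^o) x u
  - 'd (fun y => local2 w i y u t : R^o) x v
  + 'd (fun y => local2 w i y u v : R^o) x t.

Definition closed_2form (w : form2) : Prop :=
  is_2form w /\ forall q u v t, ext2 w (q := q) u v t = 0.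

Definition weak_symplectic (w : form2) : Prop :=
  closed_2form w /\
  forall (q : M) (zeta : tangent q), zeta != 0 ->
    exists nu : tangent q, w q nu zeta != 0.

End Forms.

Definition pullback2 (E F : normedModType R) (M : charted_space E)
    (N : charted_space F) (f : M -> N) (s : form2 N) : form2 M :=
  fun q u v => s (f q) (mdiff f q u) (mdiff f q v).

Section Cotangent.
Context {E : normedModType R} (N : charted_space E).

Definition cotangent_point := {q : N & dual (tangent q)}.

(* The chart of T^*N induced by a chart x of N sends (q, p) to
   (x(q), p \o (dx|_q)^-1). *)
Definition cotangent_chart (i : chart_index N) (z : cotangent_point)
    : E * dual E :=
  let q := projT1 z in
  (chart i q,
   clinear_comp (projT2 z)
     (Diff (chart (chart_at q) \o chart_inv i) (chart i q))).

Definition cotangent_chart_inv (i : chart_index N) (y : E * dual E)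
    : cotangent_point :=
  let q := chart_inv i y.1 in
  existT _ q
    (clinear_comp y.2
       (Diff (chart i \o chart_inv (chart_at q)) (chart (chart_at q) q))).

Definition cotangent : charted_space (E * dual E)%type := {|
  carrier := cotangent_point;
  chart_index := chart_index N;
  chart_dom := fun i z => chart_dom i (projT1 z);
  chart := cotangent_chart;
  chart_inv := cotangent_chart_inv;
  chart_at := fun z => chart_at (projT1 z) |}.

Definition cotangent_proj (z : cotangent) : N := projT1 z.

Definition canonical_form : form1 cotangent :=
  fun z zeta => (projT2 z) (mdiff cotangent_proj z zeta).

Definition twisted_form (sigma : form2 N) : form2 cotangent :=
  fun z u v => ext1 canonical_form u v + pullback2 cotangent_proj sigma u v.

End Cotangent.
End Manifolds.

Arguments canonical_form {R E} N q _ : rename.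

(* Main.v *)
(* In the chart of T^*N induced by a chart of N, with coordinates (x, xi), the
   canonical form is xi(dx), so that d lambda ((u, eta), (v, theta)) =
   eta v - theta u and omega_sigma differs from this constant form by the
   pull-back of sigma along (x, xi) |-> x. Exterior derivatives are computed in
   the distinguished chart of each point, so reading omega_sigma in a fixed
   chart takes a change of charts, in which d lambda is invariant because the
   second differential of a transition map is symmetric. Smoothness and
   closedness are then those of sigma. For non-degeneracy at zeta = (u, eta):
   if u = 0, pair with (v, 0) where eta v != 0; otherwise pair with (0, theta)
   where theta u != 0, theta being given by the Hahn-Banach theorem. *)
Require Import Defs.
From HB Require Import structures.
From mathcomp Require Import all_boot all_order all_algebra.
From mathcomp Require Import all_classical all_reals all_analysis.
From mathcomp Require Import ring lra.
Set Implicit Arguments.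
Unset Strict Implicit.
Unset Printing Implicit Defensive.
Import Order.TTheory GRing.Theory Num.Theory.
Import numFieldNormedType.Exports.
Local Open Scope classical_set_scope.
Local Open Scope ring_scope.

(** * Bounded operators: composition, evaluation, projections *)

Section Clinear.
Context {R : realType}.
Implicit Types E F G : normedModType R.

Lemma clinear_bounded_subproof E F (f : E -> F) (k : R) :
  linear f -> (forall x, `|f x| <= k * `|x|) -> f \in @clinear_pred R E F.
Proof.
move=> lf fk; apply/asboolP; split=> //.
pose fM := GRing.isLinear.Build _ _ _ _ f lf.
pose fL : {linear E -> F} := HB.pack f fM.
apply: (@bounded_linear_continuous _ _ _ fL).
apply/linear_boundedP.
by near=> M => x; rewrite (le_trans (fk x))// ler_wpM2r.
Unshelve. all: by end_near. Qed.

Lemma clinearP E F (f g : clinear E F) : (forall x, f x = g x) -> f = g.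
Proof. by move=> fg; apply/val_inj/funext. Qed.

Lemma clinear_norm_le E F (f : clinear E F) x : `|f x| <= `|f| * `|x|.
Proof. exact: le_opnorm. Qed.

Lemma norm_clinear_comp E F G (g : clinear F G) (f : clinear E F) :
  `|clinear_comp g f| <= `|g| * `|f|.
Proof.
apply: opnorm_le => x x1.
rewrite (le_trans (clinear_norm_le g _))// ler_wpM2l//.
exact: le_opnorm1.
Qed.

(** Together with the joint continuity below, this gives the product rule for a composition of two
    varying operators, the shape of the fibre coordinate in a change of cotangent charts. *)
Lemma clinear_comp_bilinear E F G :
  bilinear_for (GRing.Scale.Law.clone _ _ *:%R _)
    (GRing.Scale.Law.clone _ _ *:%R _) (@clinear_comp R E F G).
Proof.
split=> [f|g] a x y; apply: clinearP => z //=.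
exact: linearP.
Qed.

HB.instance Definition _ E F G := bilinear_isBilinear.Build R
  (clinear F G) (clinear E F) (clinear E G) _ _
  (@clinear_comp R E F G) (@clinear_comp_bilinear E F G).

Lemma clinear_comp_continuous E F G :
  continuous (fun p : clinear F G * clinear E F => clinear_comp p.1 p.2).
Proof.
move=> p.
have cf : (fun x : clinear F G * clinear E F => x.1) @ p --> p.1.
  exact: cvg_fst.
have cs : (fun x : clinear F G * clinear E F => x.2) @ p --> p.2.
  exact: cvg_snd.
apply/subr_cvg0/norm_cvg0P.
(* The usual telescoping of [q.1 q.2 - p.1 p.2]: this bound is continuous in [q] and vanishes at
   [p]. *)
pose m (q : clinear F G * clinear E F) :=
  `|q.1 - p.1| * `|q.2| + `|p.1| * `|q.2 - p.2|.
apply: (@squeeze_cvgr _ _ _ _ (fun=> 0) m); last 2 first.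
- exact: cvg_cst.
- have -> : 0 = `|p.1 - p.1| * `|p.2| + `|p.1| * `|p.2 - p.2| :> R.
    by rewrite !subrr !normr0 mul0r mulr0 addr0.
  apply: cvgD; apply: cvgM.
  + by apply: cvg_norm; apply: cvgB => //; exact: cvg_cst.
  + exact: cvg_norm.
  + exact: cvg_cst.
  + by apply: cvg_norm; apply: cvgB => //; exact: cvg_cst.
apply: nearW => q; rewrite normr_ge0/=.
have -> : clinear_comp q.1 q.2 - clinear_comp p.1 p.2 =
   clinear_comp (q.1 - p.1) q.2 + clinear_comp p.1 (q.2 - p.2).
  by rewrite linearBl linearBr addrA subrK.
by rewrite (le_trans (ler_normD _ _))// lerD// norm_clinear_comp.
Qed.

Lemma clinear_compr_subproof E F G (g : clinear F G) :
  (clinear_comp g : clinear E F -> _) \in @clinear_pred R _ _.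
Proof.
apply: (@clinear_bounded_subproof _ _ _ `|g|) => [a x y|f].
  by rewrite linearPr.
exact: norm_clinear_comp.
Qed.

Definition postcomp E F G (g : clinear F G) :
  clinear (clinear E F) (clinear E G) :=
  CLinear (@clinear_compr_subproof E F G g).

Lemma clinear_compl_subproof E F G (f : clinear E F) :
  (fun g : clinear F G => clinear_comp g f) \in @clinear_pred R _ _.
Proof.
apply: (@clinear_bounded_subproof _ _ _ `|f|) => [a x y|g].
  exact: clinearP.
by rewrite mulrC norm_clinear_comp.
Qed.

Definition precomp E F G (f : clinear E F) :
  clinear (clinear F G) (clinear E G) :=
  CLinear (@clinear_compl_subproof E F G f).

Lemma eval_at_subproof E F (x : E) :
  (fun f : clinear E F => f x) \in @clinear_pred R _ _.
Proof.
apply: (@clinear_bounded_subproof _ _ _ `|x|) => // f.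
by rewrite mulrC clinear_norm_le.
Qed.

Definition eval_at E F (x : E) : clinear (clinear E F) F :=
  CLinear (@eval_at_subproof E F x).

Lemma eval_clinear_subproof E F : (@eval_at E F) \in @clinear_pred R _ _.
Proof.
apply: (@clinear_bounded_subproof _ _ _ 1) => [a x y|x].
  by apply: clinearP => f /=; rewrite linearP.
rewrite mul1r; apply: opnorm_le => f f1 /=.
by rewrite (le_trans (clinear_norm_le f x))// ler_piMl.
Qed.

(** For [F] the scalars, this is the canonical map of [E] into its bidual. *)
Definition eval_clinear E F : clinear E (clinear (clinear E F) F) :=
  CLinear (@eval_clinear_subproof E F).

Lemma fst_clinear_subproof E F : (@fst E F) \in @clinear_pred R _ _.
Proof. by apply/asboolP; split=> // p; exact: cvg_fst. Qed.

Definition fst_clinear E F : clinear (E * F)%type E :=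
  CLinear (@fst_clinear_subproof E F).

Lemma snd_clinear_subproof E F : (@snd E F) \in @clinear_pred R _ _.
Proof. by apply/asboolP; split=> // p; exact: cvg_snd. Qed.

Definition snd_clinear E F : clinear (E * F)%type F :=
  CLinear (@snd_clinear_subproof E F).

Lemma id_clinear_subproof E : (@id E) \in @clinear_pred R _ _.
Proof. by apply/asboolP; split=> // p; exact: cvg_id. Qed.

Definition id_clinear E : clinear E E := CLinear (@id_clinear_subproof E).

End Clinear.

(** * Differentials as elements of L(E, F) *)

Section Diff.
Context {R : realType}.
Implicit Types E F G : normedModType R.

(** Charts are meaningful only on their domains, so differentials are computed after replacing a map
    by one that agrees with it near the point; the little-o condition sees only nearby values. *)
Lemma near_eq_is_diff E F (f g : E -> F) x (df : E -> F) :
  {near x, f =1 g} -> is_diff x f df -> is_diff x g df.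
Proof.
move=> fg [dfx <-].
have fgx : f x = g x := nbhs_singleton fg.
suff gE : g \o shift x = cst (g x) + 'd f x +o_ 0 id.
  have dgE : 'd g x = 'd f x :> (E -> F).
    by apply: diff_unique => //; exact: diff_continuous.
  apply: DiffDef => //; apply/diff_locallyP; rewrite dgE; split=> //.
  exact: diff_continuous.
apply/eqaddoP => e e0.
have /eqaddoP/(_ e e0) := diff_locally dfx.
apply: filter_app.
have /= : \forall h \near 0, f (h + x) = g (h + x).
  by move: fg; rewrite (near_shift 0 x) subr0.
apply: filterS => h fgh.
by rewrite !fctE /= -fgx fgh.
Qed.

Lemma DiffE E F (f : E -> F) x :
  differentiable f x -> Diff f x = 'd f x :> (E -> F).
Proof.
(* Differentiability includes continuity of the differential, which rules out the default value
   0. *)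
move=> df; rewrite /Diff /insubd insubT//=.
by apply/asboolP; split; [exact: linearP|exact: diff_continuous].
Qed.

Lemma is_diff_Diff E F (f : E -> F) x :
  differentiable f x -> is_diff x f (Diff f x).
Proof. by move=> df; apply: DiffDef => //; rewrite DiffE. Qed.

Lemma Diff_val E F (f : E -> F) x (L : clinear E F) :
  is_diff x f L -> Diff f x = L.
Proof. by move=> dL; apply/val_inj; rewrite /= DiffE// diff_val. Qed.

Lemma is_diff_clinear E F (f : clinear E F) x : is_diff x f f.
Proof.
have cf := @clinear_continuous _ _ _ f.
by apply: DiffDef; [exact: linear_differentiable|exact: diff_lin].
Qed.

End Diff.

(** * Stability of C^k maps *)

Section Ck.
Context {R : realType}.
Implicit Types E F G : normedModType R.

Lemma is_diff_compl E F G (g : clinear F G) (f : E -> F) x (L : clinear E F) :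
  is_diff x f L -> is_diff x (g \o f) (clinear_comp g L).
Proof. by move=> dfx; exact: (is_diff_comp dfx (is_diff_clinear g (f x))). Qed.

Lemma is_diff_compr E F G (g : clinear E F) (f : F -> G) x (L : clinear F G) :
  is_diff (g x) f L -> is_diff x (f \o g) (clinear_comp L g).
Proof. by move=> dfx; exact: (is_diff_comp (is_diff_clinear g x) dfx). Qed.

Lemma Ck_on_subset k E F (U V : set E) (f : E -> F) :
  U `<=` V -> Ck_on k V f -> Ck_on k U f.
Proof.
move=> UV; elim: k => [|k ih] in F f *; first by move=> cf x /UV; exact: cf.
by move=> [df /ih ?]; split=> // x /UV; exact: df.
Qed.

(** As [U] is open, the maps agree near each of its points, so their differentials agree on [U] and
    the induction goes on with these. *)
Lemma eq_Ck_on k E F (U : set E) (f g : E -> F) :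
  open U -> {in U, f =1 g} -> Ck_on k U f -> Ck_on k U g.
Proof.
move=> oU; elim: k => [|k ih] in F f g * => fg.
  move=> cf x Ux; have nfg : {near x, f =1 g}.
    by apply: filterS (open_nbhs_nbhs (conj oU Ux)) => y Uy; rewrite fg ?inE.
  change (g y @[y --> x] --> g x); rewrite -(nbhs_singleton nfg).
  by apply: cvg_trans (cf x Ux); exact: near_eq_cvg.
have dg x L : U x -> is_diff x f L -> is_diff x g L.
  move=> Ux; apply: near_eq_is_diff.
  by apply: filterS (open_nbhs_nbhs (conj oU Ux)) => y Uy; rewrite fg ?inE.
move=> [df Cf]; split=> [x Ux|].
  by have [] := dg x _ Ux (differentiableP (df x Ux)).
apply: ih Cf => x; rewrite inE => Ux.
by apply/esym/Diff_val/dg => //; exact/is_diff_Diff/df.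
Qed.

(** The differential of [g \o f] is [postcomp E g \o Diff f], again an operator after a map; the
    induction therefore varies the target spaces. *)
Lemma Ck_on_compl k E F G (U : set E) (g : clinear F G) (f : E -> F) :
  open U -> Ck_on k U f -> Ck_on k U (g \o f).
Proof.
move=> oU; elim: k => [|k ih] in F G g f *.
  move=> cf x Ux; apply: continuous_comp; first exact: cf.
  exact: clinear_continuous.
move=> [df Cf].
have dgf x (Ux : U x) := is_diff_compl g (is_diff_Diff (df x Ux)).
split=> [x /dgf[]//|].
apply: eq_Ck_on (ih _ _ (postcomp E g) _ Cf) => //= x.
by rewrite inE => /dgf/Diff_val ->.
Qed.

(** The differential is [Diff f \o g] followed by the operator [precomp G g]: the induction
    hypothesis handles the former and [Ck_on_compl] the latter. *)
Lemma Ck_on_compr k E F G (U : set F) (g : clinear E F) (f : F -> G) :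
  open U -> Ck_on k U f -> Ck_on k (g @^-1` U) (f \o g).
Proof.
move=> oU; have ogU : open (g @^-1` U).
  by apply: open_comp => // x _; exact: clinear_continuous.
elim: k => [|k ih] in G f *.
  move=> cf x Ux; apply: continuous_comp; first exact: clinear_continuous.
  exact: cf.
move=> [df Cf].
have dfg x (Ux : U (g x)) := is_diff_compr (is_diff_Diff (df _ Ux)).
split=> [x /dfg[]//|].
apply: eq_Ck_on (Ck_on_compl (precomp G g) ogU (ih _ _ Cf)) => //= x.
by rewrite inE => /dfg/Diff_val ->.
Qed.

Lemma Ck_on_addl k E F (U : set E) (c : F) (f : E -> F) :
  open U -> Ck_on k U f -> Ck_on k U (fun x => c + f x).
Proof.
move=> oU; case: k => [|k].
  by move=> cf x Ux; apply: cvgD; [exact: cvg_cst|exact: cf].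
move=> [df Cf].
have dcf x : U x -> is_diff x (fun x => c + f x) (Diff f x).
  move=> Ux; have dcf := is_diffD (is_diff_cst c x) (is_diff_Diff (df x Ux)).
  apply: is_diff_eq dcf _.
  by rewrite add0r.
split=> [x /dcf[]//|].
apply: (eq_Ck_on oU _ Cf) => x; rewrite inE => /dcf Dx.
by rewrite (Diff_val Dx).
Qed.

End Ck.

(** * Symmetry of second differentials *)

Section Schwarz.
Context {R : realType} (E : normedModType R).

Lemma derive_segment (g : E -> R^o) (z b : E) (s : R) (L : dual E) :
  is_diff (z + s *: b) g L -> is_derive s 1 (fun s => g (z + s *: b)) (L b).
Proof.
move=> dg.
have db : is_diff s (fun s => z + s *: b) ( *:%R^~ b).
  apply: is_diff_eq (is_diffD (is_diff_cst z s) (is_diff_scalel s b)) _.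
  by rewrite add0r.
have [df dE] := is_diff_comp db dg.
apply: DeriveDef; first exact/derivable1_diffP.
by rewrite deriveE// dE /= scale1r.
Qed.

(* Mean value theorem for s |-> g (x + t a + s b) - g (x + s b) on [0, t]. *)
Lemma second_difference (g : E -> R^o) (G : E -> dual E)
    (H : clinear E (dual E)) (x a b : E) (e d t : R) :
  0 < e -> 0 < t -> t * (`|a| + `|b|) < d ->
  (forall h, `|h| < d -> is_diff (x + h) g (G (x + h))) ->
  (forall h, `|h| < d -> `|G (x + h) - G x - H h| <= e * `|h|) ->
  `|g (x + t *: a + t *: b) - g (x + t *: a) - g (x + t *: b) + g x
    - t ^+ 2 * H a b| <= 2 * e * t ^+ 2 * (`|a| + `|b|) ^+ 2.
Proof.
move=> e0 t0 td dg GH.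
pose f s := g (x + t *: a + s *: b) - g (x + s *: b).
pose df s := (G (x + t *: a + s *: b) - G (x + s *: b)) b.
have small1 s : 0 <= s <= t -> `|s *: b| < d.
  move=> /andP[s0 st]; rewrite normrZ ger0_norm// (le_lt_trans _ td)//.
  by rewrite ler_pM// lerDr.
have small2 s : 0 <= s <= t -> `|t *: a + s *: b| <= t * (`|a| + `|b|).
  move=> /andP[s0 st]; rewrite (le_trans (ler_normD _ _))// mulrDr.
  by rewrite !normrZ !ger0_norm ?(ltW t0)// lerD2l ler_wpM2r.
have fdf s : 0 <= s <= t -> is_derive s 1 f (df s).
  move=> st; apply: is_deriveB.
    apply: derive_segment; rewrite -addrA.
    exact/dg/(le_lt_trans (small2 _ st)).
  by apply: derive_segment; exact/dg/small1.
have [c | |c c0t] := @MVT R f df 0 t t0.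
- by rewrite in_itv/= => /andP[? ?]; apply: fdf; rewrite !ltW.
- apply: derivable_within_continuous => c; rewrite in_itv/= => /fdf[+ _]; exact.
have {c0t}ct : 0 <= c <= t.
  by move: c0t; rewrite in_itv/= => /andP[? ?]; rewrite !ltW.
rewrite subr0 /f scale0r !addr0 => fE.
have -> : g (x + t *: a + t *: b) - g (x + t *: a) - g (x + t *: b) + g x
    - t ^+ 2 * H a b = t * (df c - t * H a b).
  rewrite mulrBr (mulrC t (df c)) -fE; ring.
rewrite normrM gtr0_norm// expr2 -!mulrA (mulrCA e) (mulrCA 2) ler_pM2l//.
(* Since [H (t a + c b)] and [H (c b)] differ by [t H a], the error is a difference of two
   first-order remainders of [G] at [x]. *)
have -> : df c - t * H a b =
   (G (x + (t *: a + c *: b)) - G x - H (t *: a + c *: b)) b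
   - (G (x + c *: b) - G x - H (c *: b)) b.
  rewrite /df -(addrA x); set P := G _; set Q := G _.
  have -> : H (t *: a + c *: b) = t *: H a + H (c *: b).
    by rewrite linearD linearZ.
  change ((P b - Q b) - t * H a b = 
    P b - G x b - (t * H a b + H (c *: b) b) - (Q b - G x b - H (c *: b) b)).
  ring.
rewrite (le_trans (ler_normB _ _))//.
set S := `|a| + `|b|.
have S0 : 0 <= S by rewrite addr_ge0.
have bS : `|b| <= S by rewrite lerDr.
have -> : 2 * (e * (t * S ^+ 2)) = e * (t * S) * S + e * (t * S) * S by ring.
have bound h : `|h| < d -> `|h| <= t * S ->
    `|(G (x + h) - G x - H h) b| <= e * (t * S) * S.
  move=> hd hS; rewrite (le_trans (clinear_norm_le _ b))// ler_pM//.
  by rewrite (le_trans (GH _ hd))// ler_wpM2l// ltW.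
apply: lerD; apply: bound.
- exact: le_lt_trans (small2 _ ct) td.
- exact: small2.
- exact: small1.
- have /andP[c0 c1] := ct.
  by rewrite normrZ ger0_norm// ler_pM.
Qed.

(** The second difference of [g] is unchanged when [a] and [b] are swapped. Subtracting its two
    estimates and dividing by [t ^+ 2] leaves a bound proportional to an arbitrary [e]. *)
Lemma diff2_sym (g : E -> R^o) (G : E -> dual E) (H : clinear E (dual E))
    (x : E) :
  (\forall y \near x, is_diff y g (G y)) -> is_diff x G H ->
  forall a b, H a b = H b a.
Proof.
move=> ndg dG a b; apply/eqP; rewrite -subr_eq0 -normr_le0.
set S := `|a| + `|b|.
have S0 : 0 <= S by rewrite addr_ge0.
suff key e : 0 < e -> `|H a b - H b a| <= e * (4 * S ^+ 2).
  apply/ler_addgt0Pl => e e0; rewrite addr0.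
  (* The added 1 keeps the divisor positive when [a = b = 0]. *)
  have S1 : 0 < 4 * S ^+ 2 + 1 by rewrite ltr_wpDl// mulr_ge0// exprn_ge0.
  rewrite (le_trans (key (e / (4 * S ^+ 2 + 1)) _)) ?divr_gt0//.
  by rewrite -mulrA ler_piMr ?(ltW e0)// mulrC ler_pdivrMr// mul1r lerDl.
move=> e0.
have : \forall h \near 0, is_diff (x + h) g (G (x + h)) /\
    `|G (x + h) - G x - H h| <= e * `|h|.
  near=> h; split.
    near: h; move: ndg; rewrite (near_shift 0 x).
    by apply: filterS => h; rewrite /= subr0 addrC.
  near: h.
  have /eqaddoP/(_ e e0) := diff_locally (@ex_diff _ _ _ _ _ _ _ dG).
  by apply: filterS => h; rewrite !fctE /= diff_val opprD addrA (addrC h).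
move=> /nbhs_ballP[d /= d0 dP].
have dPh h : `|h| < d -> is_diff (x + h) g (G (x + h)) /\
    `|G (x + h) - G x - H h| <= e * `|h|.
  by move=> hd; apply: dP; rewrite -ball_normE/= sub0r normrN.
have [t t0 tS] : exists2 t, 0 < t & t * S < d.
  exists (d / (S + 1)); first by rewrite divr_gt0// ltr_wpDl.
  by rewrite -mulrA gtr_pMr// ltr_pdivrMl ?mulr1 ?ltrDl// ltr_wpDl.
have h1 := second_difference e0 t0 tS (fun h hd => (dPh h hd).1)
   (fun h hd => (dPh h hd).2).
have tS' : t * (`|b| + `|a|) < d by rewrite addrC.
have h2 := second_difference e0 t0 tS' (fun h hd => (dPh h hd).1)
   (fun h hd => (dPh h hd).2).
have t2 : 0 < t ^+ 2 by rewrite exprn_gt0.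
rewrite -(ler_pM2l t2) -[X in X * `|_|]gtr0_norm// -normrM.
have -> : t ^+ 2 * (H a b - H b a) =
  (g (x + t *: b + t *: a) - g (x + t *: b) - g (x + t *: a) + g x
    - t ^+ 2 * H b a)
  - (g (x + t *: a + t *: b) - g (x + t *: a) - g (x + t *: b) + g x
    - t ^+ 2 * H a b).
  by rewrite (addrAC x); ring.
rewrite (le_trans (ler_normB _ _))// (le_trans (lerD h2 h1))//.
rewrite (addrC `|b|) -/S; lra.
Unshelve. all: by end_near. Qed.

End Schwarz.

(** * Separation of points by the dual, via minimal sublinear functionals *)

Section HahnBanach.
Context {R : realType} (E : normedModType R).
Implicit Types (p q : E -> R) (x y : E).

Definition sublinear p :=
  (forall x y, p (x + y) <= p x + p y) /\
  (forall (a : R) x, 0 <= a -> p (a *: x) = a * p x).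

Lemma sublinear0 p : sublinear p -> p 0 = 0.
Proof. by move=> [_ pZ]; rewrite -(scale0r 0) pZ// mul0r. Qed.

Lemma sublinear_of_le p : p 0 = 0 ->
  (forall x y, p (x + y) <= p x + p y) ->
  (forall (a : R) x, 0 < a -> p (a *: x) <= a * p x) -> sublinear p.
Proof.
move=> p0 pD le; split=> // a x.
rewrite le_eqVlt => /predU1P[<-|a0]; first by rewrite scale0r mul0r.
apply/eqP; rewrite eq_le le//=.
have := le a^-1 (a *: x); rewrite invr_gt0 => /(_ a0).
by rewrite scalerA mulVf ?gt_eqF// scale1r ler_pdivlMl.
Qed.

(** From [0 = p (x - x) <= p x + p (- x)]; it bounds from below the infimum over a chain of
    functionals. *)
Lemma sublinear_ge p x : sublinear p -> - p (- x) <= p x.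
Proof.
move=> sp; rewrite -subr_ge0 opprK -(sublinear0 sp) -[X in p X](subrr x).
exact: sp.1.
Qed.

(* The directional lowering inf_(t >= 0) (p (x + t y) - t p y) of p: it is again
   sublinear and below p, so a minimal sublinear functional satisfies
   p x <= p (x + y) - p y, whence it is additive. *)
Definition shift_set p y x :=
  [set p (x + t *: y) - t * p y | t in [set t : R | 0 <= t]].

Definition sublinear_shift p y x : R := inf (shift_set p y x).

Section Shift.
Context (p : E -> R) (y : E) (sp : sublinear p).

Lemma shift_set_lbound x : lbound (shift_set p y x) (- p (- x)).
Proof.
move=> _ [t /= t0 <-]; rewrite -sp.2//.
by have := sp.1 (x + t *: y) (- x); rewrite addrAC subrr add0r; lra.
Qed.

Lemma shift_set_has_inf x : has_inf (shift_set p y x).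
Proof.
split; first by exists (p (x + 0 *: y) - 0 * p y), 0 => /=.
by exists (- p (- x)); exact: shift_set_lbound.
Qed.

Lemma sublinear_shift_le x t :
  0 <= t -> sublinear_shift p y x <= p (x + t *: y) - t * p y.
Proof.
by move=> t0; apply: ge_inf; [exact: (shift_set_has_inf x).2|exists t].
Qed.

Lemma le_sublinear_shift x c :
  (forall t, 0 <= t -> c <= p (x + t *: y) - t * p y) ->
  c <= sublinear_shift p y x.
Proof.
move=> h; apply: lb_le_inf; first exact: (shift_set_has_inf x).1.
by move=> _ [t /= t0 <-]; exact: h.
Qed.

Lemma sublinear_shift_le_self x : sublinear_shift p y x <= p x.
Proof.
by have := sublinear_shift_le x (lexx 0); rewrite scale0r addr0 mul0r subr0.
Qed.

Lemma sublinear_shift_sublinear : sublinear (sublinear_shift p y).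
Proof.
apply: sublinear_of_le => [|x z|b z b0].
- apply/eqP; rewrite eq_le; apply/andP; split.
    by rewrite (le_trans (sublinear_shift_le_self 0))// sublinear0.
  by apply: le_sublinear_shift => t t0; rewrite add0r sp.2// subrr.
- rewrite -lerBlDr; apply: le_sublinear_shift => t t0.
  rewrite lerBlDr -lerBlDl; apply: le_sublinear_shift => s s0.
  (* Parameters [t] for [x] and [s] for [z] combine into [t + s] for [x + z]. *)
  rewrite lerBlDl (le_trans (sublinear_shift_le _ (addr_ge0 t0 s0)))//.
  have := sp.1 (x + t *: y) (z + s *: y).
  rewrite addrACA -scalerDl => h; rewrite mulrDl; lra.
- rewrite -ler_pdivrMl//; apply: le_sublinear_shift => t t0.
  rewrite ler_pdivrMl//.
  (* Homogeneity comes from rescaling the parameter [t] to [b * t]. *)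
  have := sublinear_shift_le (b *: z) (mulr_ge0 (ltW b0) t0).
  by rewrite -scalerA -scalerDr sp.2 ?(ltW b0)// -mulrA -mulrBr.
Qed.

End Shift.

Lemma minimal_sublinear p : sublinear p ->
  (forall q, sublinear q -> (forall x, q x <= p x) -> q = p) ->
  linear (p : E -> R^o).
Proof.
move=> sp minp.
have pD x y : p (x + y) = p x + p y.
  apply/eqP; rewrite eq_le sp.1/=.
  have := sublinear_shift_le y sp x ler01.
  rewrite (minp _ (sublinear_shift_sublinear y sp)); last first.
    exact: sublinear_shift_le_self.
  by rewrite scale1r mul1r lerBrDr.
have pN x : p (- x) = - p x.
  by apply/eqP; rewrite -addr_eq0 -pD addrC subrr sublinear0.
move=> a x y; rewrite pD; congr (_ + _).
have [a0|a0] := leP 0 a; first exact: sp.2.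
rewrite -[in LHS](opprK a) scaleNr pN sp.2 ?oppr_ge0 ?ltW//.
by rewrite mulNr opprK.
Qed.

Lemma exists_minimal_sublinear p : sublinear p -> exists f, [/\ sublinear f,
  (forall x, f x <= p x) &
  (forall q, sublinear q -> (forall x, q x <= f x) -> q = f)].
Proof.
move=> sp.
pose T := {q : E -> R | sublinear q /\ forall x, q x <= p x}.
(* The pointwise order is reversed, so that a maximal element for Zorn is a minimal functional. *)
pose ge (s t : T) := `[< forall x, sval t x <= sval s x >].
have [| | | |f fmin] := @Zorn T ge.
- by move=> t; apply/asboolP.
- move=> r s t /asboolP rs /asboolP st; apply/asboolP => x.
  exact: le_trans (rs x).
- move=> [s Ps] [t Pt] /asboolP/= st /asboolP/= ts; apply: eq_exist.
  by apply/funext => x; apply/eqP; rewrite eq_le ts st.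
- move=> A totA.
  (* The empty chain is bounded by [p]; a nonempty one by its pointwise infimum [m]. *)
  have [[t0 At0]|A0] := pselect (A !=set0); last first.
    exists (exist _ p (conj sp (fun x => lexx (p x)))) => s As.
    by exfalso; apply: A0; exists s.
  pose V x := [set sval t x | t in A].
  have Vlb x : lbound (V x) (- p (- x)).
    move=> _ [[t [st tp]] At <-] /=.
    by rewrite (le_trans _ (sublinear_ge x st))// lerN2.
  have Vinf x : has_inf (V x).
    by split; [exists (sval t0 x), t0|exists (- p (- x)); exact: Vlb].
  pose m x := inf (V x).
  have mle t x : A t -> m x <= sval t x.
    by move=> At; apply: ge_inf; [exact: (Vinf x).2|exists t].
  have lem x c : (forall t, A t -> c <= sval t x) -> c <= m x.
    move=> h; apply: lb_le_inf; first exact: (Vinf x).1.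
    by move=> _ [t At <-]; exact: h.
  have sm : sublinear m.
    apply: sublinear_of_le => [|x y|b z b0].
    - apply/eqP; rewrite eq_le; apply/andP; split.
        rewrite (le_trans (mle t0 _ At0))// sublinear0//.
        exact: (svalP t0).1.
      by apply: (lem 0) => t At; rewrite sublinear0//; exact: (svalP t).1.
    - rewrite -lerBlDr; apply: (lem x) => s As.
      rewrite lerBlDr -lerBlDl; apply: (lem y) => t At.
      (* Totality of the chain enters here: the smaller of [s] and [t] is subadditive and lies below
         both. *)
      rewrite lerBlDl; have [/asboolP st|/asboolP ts] := totA s t As At.
        rewrite (le_trans (mle t _ At))// (le_trans ((svalP t).1.1 _ _))//.
        by rewrite lerD2r.
      rewrite (le_trans (mle s _ As))// (le_trans ((svalP s).1.1 _ _))//.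
      by rewrite lerD2l.
    - rewrite -ler_pdivrMl//; apply: (lem z) => t At.
      by rewrite ler_pdivrMl// -(svalP t).1.2 ?(ltW b0)// mle.
  have mp x : m x <= p x.
    by rewrite (le_trans (mle t0 _ At0))//; exact: (svalP t0).2.
  by exists (exist _ m (conj sm mp)) => s As; apply/asboolP => x; exact: mle.
case: f fmin => f [sf fp] fmin; exists f; split=> // q sq qf.
have qp x : q x <= p x by exact: le_trans (qf x) (fp x).
have := fmin (exist _ q (conj sq qp)) => /(_ _)/(congr1 sval)/=; apply.
by apply/asboolP.
Qed.

(** Lower the norm along [x]: with parameter 1, its value at [- x] is at most [- |x|]. A minimal
    functional below it is linear, is dominated by the norm, and is negative at [- x]. *)
Lemma dual_separates (x : E) : x != 0 -> exists f : dual E, f x != 0.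
Proof.
move=> x0; pose n (y : E) := `|y|.
have sn : sublinear n.
  split=> [y z|a y a0]; first exact: ler_normD.
  by rewrite /n normrZ ger0_norm.
have [f [sf fn minf]] :=
  exists_minimal_sublinear (sublinear_shift_sublinear x sn).
have lf := minimal_sublinear sf minf.
have fle y : f y <= `|y|.
  exact: le_trans (fn y) (sublinear_shift_le_self x sn y).
have fN y : f (- y) = - f y.
  apply/eqP; rewrite -addr_eq0; apply/eqP.
  by have := lf 1 (- y) y; rewrite !scale1r addNr sublinear0.
have fB : (f : E -> R^o) \in @clinear_pred R E R^o.
  apply: (@clinear_bounded_subproof _ _ _ _ 1) => // y.
  by rewrite mul1r ler_norml fle andbT lerNl -fN -normrN fle.
exists (CLinear fB) => /=.
suff : f (- x) < 0 by rewrite fN oppr_lt0 => /gt_eqF ->.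
rewrite (le_lt_trans (fn _))//.
rewrite (le_lt_trans (sublinear_shift_le x sn (- x) ler01))//.
by rewrite scale1r addNr /n normr0 mul1r sub0r oppr_lt0 normr_gt0.
Qed.

End HahnBanach.

(** * Transition maps and their differentials *)

Section Transitions.
Context {R : realType} {E : normedModType R} {N : charted_space E}.
Hypothesis hN : smooth_manifold N.
Implicit Types (i j k : chart_index N) (q : N) (x : E).

Definition transition i j : E -> E := chart j \o chart_inv i.

Definition overlap i j : set E := chart i @` (chart_dom i `&` chart_dom j).

Definition dtransition i j (x : E) : clinear E E := Diff (transition i j) x.

Lemma overlap_self i : overlap i i = chart i @` chart_dom i.
Proof. by rewrite /overlap setIid. Qed.

Lemma chart_at_dom q : chart_dom (chart_at q) q.
Proof. by case: hN. Qed.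

Lemma chart_invK i q : chart_dom i q -> chart_inv i (chart i q) = q.
Proof. by case: hN => _ + _ _; apply. Qed.

Lemma overlap_chart i j q :
  chart_dom i q -> chart_dom j q -> overlap i j (chart i q).
Proof. by exists q. Qed.

Lemma overlapP i j x : overlap i j x ->
  exists q, [/\ chart_dom i q, chart_dom j q & x = chart i q].
Proof. by move=> [q [qi qj] <-]; exists q. Qed.

(** A local expression in the chart [i] reads vectors in the distinguished chart of the point; this
    places that change of charts within the transition calculus. *)
Lemma overlap_chart_at i x :
  overlap i i x -> overlap i (chart_at (chart_inv i x)) x.
Proof.
move=> /overlapP[q [qi _ ->]]; rewrite chart_invK//.
by apply: overlap_chart => //; exact: chart_at_dom.
Qed.

Lemma overlapl i j x : overlap i j x -> overlap i i x.
Proof. by move=> /overlapP[q [qi _ ->]]; exact: overlap_chart. Qed.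

Lemma open_overlap i j : open (overlap i j).
Proof. by have [_ _ + _] := hN; apply. Qed.

Lemma near_overlap i j x : overlap i j x -> \forall y \near x, overlap i j y.
Proof.
by move=> xij; apply: open_nbhs_nbhs; split=> //; exact: open_overlap.
Qed.

Lemma overlap_transition i j k x :
  overlap i j x -> overlap i k x -> overlap j k (transition i j x).
Proof.
move=> /overlapP[q [qi qj ->]] /overlapP[q' [q'i q'k qq']].
have qE : q' = q by rewrite -(chart_invK q'i) -qq' chart_invK.
rewrite /transition /= chart_invK//; apply: overlap_chart => //.
by rewrite -qE.
Qed.

Lemma transition_comp i j k x :
  overlap i j x -> transition j k (transition i j x) = transition i k x.
Proof.
by move=> /overlapP[q [qi qj ->]]; rewrite /transition/= !chart_invK.
Qed.

Lemma transition_self i x : overlap i i x -> transition i i x = x.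
Proof. by move=> /overlapP[q [qi _ ->]]; rewrite /transition/= chart_invK. Qed.

Lemma is_diff_transition i j x :
  overlap i j x -> is_diff x (transition i j) (dtransition i j x).
Proof.
move=> xij; apply: is_diff_Diff; have [_ _ _ /(_ i j)/(_ 1)[+ _]] := hN; exact.
Qed.

Lemma is_diff_dtransition i j x : overlap i j x ->
  is_diff x (dtransition i j) (Diff (dtransition i j) x).
Proof.
move=> xij; apply: is_diff_Diff.
by have [_ _ _ /(_ i j)/(_ 2)[_ [+ _]]] := hN; apply.
Qed.

(** The cocycle identity holds on a neighbourhood, overlaps being open, so the chain rule
    differentiates it. *)
Lemma dtransition_comp i j k x : overlap i j x -> overlap i k x ->
  clinear_comp (dtransition j k (transition i j x)) (dtransition i j x) =
  dtransition i k x.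
Proof.
move=> xij xik; apply/esym/Diff_val.
have dij := is_diff_transition xij.
have djk := is_diff_transition (overlap_transition xij xik).
apply: near_eq_is_diff (is_diff_comp dij djk).
by apply: filterS (near_overlap xij) => y yij; exact: transition_comp.
Qed.

Lemma dtransition_self i x v : overlap i i x -> dtransition i i x v = v.
Proof.
move=> xi; suff -> : dtransition i i x = id_clinear E by [].
apply: Diff_val; apply: near_eq_is_diff (is_diff_clinear (id_clinear E) x).
by apply: filterS (near_overlap xi) => y yi; rewrite transition_self.
Qed.

Lemma dtransitionK i j x v : overlap i j x ->
  dtransition j i (transition i j x) (dtransition i j x v) = v.
Proof.
move=> xij; have xi := overlapl xij.
rewrite -[RHS](dtransition_self v xi) -(dtransition_comp xij xi).
by [].
Qed.

Lemma local2_chart_at (w : form2 N) q u v :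
  local2 w (chart_at q) (chart (chart_at q) q) u v = w q u v.
Proof.
have qc := chart_at_dom q.
have xc := overlap_chart qc qc.
pose c := chart_at q.
(* All tangent spaces unfold to [E]; typing the vectors there lets the base point be rewritten
   without transporting them. *)
pose W q' (u v : E) : R := w q' u v.
change (W (chart_inv c (chart c q))
  (dtransition c (chart_at (chart_inv c (chart c q))) (chart c q) u)
  (dtransition c (chart_at (chart_inv c (chart c q))) (chart c q) v) = W q u v).
by rewrite chart_invK// !dtransition_self.
Qed.

(** Composing the transition with the covector [xi] reduces this to the symmetry proved for
    real-valued maps. *)
Lemma diff2_transition_sym i j x (xi : dual E) u v : overlap i j x ->
  xi (Diff (dtransition i j) x u v) = xi (Diff (dtransition i j) x v u).
Proof.
move=> xij; pose H := clinear_comp (postcomp E xi) (Diff (dtransition i j) x).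
change (H u v = H v u).
apply: (@diff2_sym _ _ (xi \o transition i j)
  (postcomp E xi \o dtransition i j) H x).
  apply: filterS (near_overlap xij) => y yij.
  exact: is_diff_compl (is_diff_transition yij).
exact: is_diff_compl (is_diff_dtransition xij).
Qed.

End Transitions.

(** * Cotangent charts and local expressions of the canonical and twisted forms *)

Lemma is_diff_clinear_comp (R : realType) (E F G : normedModType R)
    (p : clinear F G * clinear E F) :
  is_diff p (fun q => clinear_comp q.1 q.2)
    (fun q => clinear_comp p.1 q.2 + clinear_comp q.1 p.2).
Proof.
by apply: DiffDef; [apply: differentiable_bilin|apply: diff_bilin];
  exact: clinear_comp_continuous.
Qed.

Section Cotangent.
Context {R : realType} {E : normedModType R} {N : charted_space E}.
Hypothesis hN : smooth_manifold N.
Implicit Types (i j : chart_index N) (y W : E * dual E).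

(** The inverse of the differential of a transition is written as the differential of the reverse
    transition, so the chain and product rules apply directly. *)
Definition cotangent_transition i j y : E * dual E :=
  (transition i j y.1,
   clinear_comp y.2 (dtransition j i (transition i j y.1))).

Lemma near_overlap_fst i j y :
  overlap i j y.1 -> \forall z \near y, overlap i j z.1.
Proof.
move=> yij.
exact: (@cvg_fst _ _ (nbhs y.1) (nbhs y.2) _ _ (near_overlap hN yij)).
Qed.

(** Covectors are stored in the distinguished chart [c] of the base point; the cocycle relation
    eliminates this intermediate chart. *)
Lemma cotangent_transitionE i j y : overlap i j y.1 ->
  cotangent_chart j (cotangent_chart_inv i y) = cotangent_transition i j y.
Proof.
case: y => x xi /= xij.
have xic := overlap_chart_at hN (overlapl xij).
set c := chart_at (chart_inv i x) in xic.
have xiE : clinear_comp (clinear_comp xi (dtransition c i (transition i c x)))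
    (dtransition j c (transition i j x)) =
    clinear_comp xi (dtransition j i (transition i j x)).
  have xji := overlap_transition hN xij (overlapl xij).
  rewrite -(dtransition_comp hN (overlap_transition hN xij xic) xji).
  by rewrite transition_comp//; exact: clinearP.
exact: (congr1 (pair (transition i j x)) xiE).
Qed.

Lemma is_diff_cotangent_transition i j y : overlap i j y.1 ->
  is_diff y (cotangent_transition i j) (fun W => (dtransition i j y.1 W.1,
    clinear_comp y.2
      (Diff (dtransition j i) (transition i j y.1) (dtransition i j y.1 W.1))
    + clinear_comp W.2 (dtransition j i (transition i j y.1)))).
Proof.
move=> yij.
have dt : is_diff y (transition i j \o fst) (dtransition i j y.1 \o fst).
  exact: is_diff_compr (fst_clinear _ _) _ _ _ (is_diff_transition hN yij).
have yji := overlap_transition hN yij (overlapl yij).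
have dD := is_diff_comp dt (is_diff_dtransition hN yji).
have ds := is_diff_clinear (snd_clinear E (dual E)) y.
have dp := is_diff_pair ds dD.
have dc := is_diff_comp dp (is_diff_clinear_comp _).
exact: is_diff_pair dt dc.
Qed.

Lemma Diff_cotangent_transition i j y W : overlap i j y.1 ->
  Diff (cotangent_chart j \o cotangent_chart_inv i) y W =
  (dtransition i j y.1 W.1,
    clinear_comp y.2
      (Diff (dtransition j i) (transition i j y.1) (dtransition i j y.1 W.1))
    + clinear_comp W.2 (dtransition j i (transition i j y.1))).
Proof.
move=> yij.
have CE : {near y, cotangent_transition i j =1
    (cotangent_chart j \o cotangent_chart_inv i)}.
  have := near_overlap_fst yij.
  by apply: filterS => z zij; exact/esym/cotangent_transitionE.
have [dC dCE] := near_eq_is_diff CE (is_diff_cotangent_transition yij).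
by rewrite DiffE// dCE.
Qed.

(** The distinguished chart at [z] is induced by the one at its base point, so in these charts the
    projection is locally [fst]. *)
Lemma mdiff_cotangent_proj (z : cotangent N) (W : tangent z) :
  mdiff (@cotangent_proj R E N) z W = W.1.
Proof.
pose q := projT1 z; pose c := chart_at q.
have qc : chart_dom c q := chart_at_dom hN q.
suff dp : is_diff (cotangent_chart c z)
    (chart c \o @cotangent_proj R E N \o cotangent_chart_inv c)
    (fst_clinear E (dual E)).
  by rewrite /mdiff (Diff_val dp).
apply: near_eq_is_diff (is_diff_clinear (fst_clinear E (dual E)) _).
have zc : overlap c c (cotangent_chart c z).1 by exact: overlap_chart.
have := near_overlap_fst zc.
by apply: filterS => y yc; exact: esym (transition_self hN yc).
Qed.

Lemma local1_canonical_form i y W : overlap i i y.1 ->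
  local1 (canonical_form N) i y W = y.2 W.1.
Proof.
move=> yi; have yic := overlap_chart_at hN yi.
rewrite /local1 /canonical_form mdiff_cotangent_proj.
set c := chart_at (chart_inv i y.1) in yic *.
change (y.2 (dtransition c i (transition i c y.1)
  (Diff (cotangent_chart c \o cotangent_chart_inv i) y W).1) = y.2 W.1).
by rewrite Diff_cotangent_transition//= dtransitionK.
Qed.

Lemma ext1_canonical_form (z : cotangent N) (U V : tangent z) :
  ext1 (canonical_form N) U V = (U.2 : dual E) V.1 - (V.2 : dual E) U.1.
Proof.
pose q := projT1 z; pose c := chart_at q.
have qc : chart_dom c q := chart_at_dom hN q.
have zc : overlap c c (cotangent_chart c z).1 by exact: overlap_chart.
(* For fixed [W], the local expression [y.2 W.1] is bounded linear in [y], hence is its own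
   differential. *)
suff key (W : E * dual E) : is_diff (cotangent_chart c z)
   (fun y => local1 (canonical_form N) c y W : R^o)
   (clinear_comp (eval_at R^o W.1) (snd_clinear E (dual E))).
  by rewrite /ext1 !(@diff_val _ _ _ _ _ _ _ (key _)).
apply: near_eq_is_diff (is_diff_clinear _ _).
have := near_overlap_fst zc.
by apply: filterS => y yc; rewrite local1_canonical_form.
Qed.

Context (sigma : form2 N).

Lemma twisted_formE (z : cotangent N) (U V : tangent z) :
  twisted_form sigma U V = (U.2 : dual E) V.1 - (V.2 : dual E) U.1
    + sigma (q := projT1 z) U.1 V.1.
Proof.
by rewrite /twisted_form ext1_canonical_form /pullback2 !mdiff_cotangent_proj.
Qed.

(** Smoothness and [ext2] concern a fixed chart at varying points, whose distinguished charts may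
    vary as well; hence this formula in any induced chart. *)
Lemma local2_twisted_form i y U V : overlap i i y.1 ->
  local2 (twisted_form sigma) i y U V =
  U.2 V.1 - V.2 U.1 + local2 sigma i y.1 U.1 V.1.
Proof.
move=> yi; have yic := overlap_chart_at hN yi.
rewrite /local2 twisted_formE.
set c := chart_at (chart_inv i y.1) in yic *.
pose dC := Diff (cotangent_chart c \o cotangent_chart_inv i) y.
change ((dC U).2 (dC V).1 - (dC V).2 (dC U).1
  + sigma (q := chart_inv i y.1) (dC U).1 (dC V).1 =
  U.2 V.1 - V.2 U.1 + local2 sigma i y.1 U.1 V.1).
rewrite /dC !Diff_cotangent_transition//=.
congr (_ + _).
set x' := transition i c y.1; set D2 := Diff _ x'.
set u := dtransition i c y.1 U.1; set v := dtransition i c y.1 V.1.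
change (y.2 (D2 u v) + U.2 (dtransition c i x' v)
  - (y.2 (D2 v u) + V.2 (dtransition c i x' u)) = U.2 V.1 - V.2 U.1).
(* The terms in [D2] come from differentiating the fibre coordinate and cancel by symmetry. *)
rewrite !dtransitionK// [y.2 (D2 u v)]diff2_transition_sym//; last first.
  exact: overlap_transition (overlapl yic).
ring.
Qed.

End Cotangent.

(** * Smoothness, closedness and non-degeneracy of the twisted form *)

Section CanonicalPairing.
Context {R : realType} (E : normedModType R).
Notation EE := (E * dual E)%type.

(** The standard symplectic form, taking [(u, eta)] and [(v, theta)] to [eta v - theta u]. *)
Definition canonical_pairing : clinear EE (dual EE) :=
  clinear_comp (precomp _ (fst_clinear E (dual E))) (snd_clinear E (dual E))
  - clinear_comp (precomp _ (snd_clinear E (dual E)))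
      (clinear_comp (eval_clinear E R^o) (fst_clinear E (dual E))).

(** Pull-back of bilinear forms along [fst], itself a bounded operator, so that it preserves
    smoothness by [Ck_on_compl]. *)
Definition pull_bilinear_fst :
    clinear (clinear E (dual E)) (clinear EE (dual EE)) :=
  clinear_comp (postcomp _ (precomp _ (fst_clinear E (dual E))))
    (precomp _ (fst_clinear E (dual E))).

End CanonicalPairing.

Section Twisted.
Context {R : realType} {E : normedModType R} {N : charted_space E}.
Hypothesis hN : smooth_manifold N.
Context (sigma : form2 N).

Lemma twisted_form_is_2form : is_2form sigma -> is_2form (twisted_form sigma).
Proof.
move=> [sigma0 sigmaC]; split=> [z U|i].
  by rewrite (twisted_formE hN) sigma0 addr0 subrr.
have [B [sB BE]] := sigmaC i.
have oi := open_overlap hN i i.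
exists (fun y => canonical_pairing E + pull_bilinear_fst E (B y.1)).
have dom y : (@chart _ _ (cotangent N) i @` @chart_dom _ _ (cotangent N) i) y ->
    @overlap R E N i i y.1.
  by move=> [z zi <-]; exact: overlap_chart.
split=> [k|y /dom yi U V].
  apply: (@Ck_on_subset _ _ _ _ _
    (fst_clinear E (dual E) @^-1` @overlap R E N i i)).
    exact: dom.
  apply: Ck_on_addl.
    by apply: open_comp => // x _; exact: clinear_continuous.
  apply: (@Ck_on_compr _ _ _ _ _ _ (fst_clinear E (dual E))
    (pull_bilinear_fst E \o B)) => //.
  by apply: Ck_on_compl => //; rewrite overlap_self; exact: sB.
rewrite (local2_twisted_form hN _ _ _ yi) BE -?overlap_self//.
Qed.

Lemma twisted_form_ext2 (z : cotangent N) (U V W : tangent z) :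
  is_2form sigma ->
  ext2 (twisted_form sigma) U V W =
  ext2 sigma (q := projT1 z) U.1 V.1 W.1.
Proof.
move=> [_ sigmaC]; pose q := projT1 z; pose c := chart_at q.
have qc : chart_dom c q := chart_at_dom hN q.
have qcc : overlap c c (chart c q) by exact: overlap_chart.
have zc : overlap c c (cotangent_chart c z).1 by [].
have [B [sB BE]] := sigmaC c.
pose x0 := chart c q; pose z0 := cotangent_chart c z.
pose loc v w x : R^o := local2 sigma c x v w.
have dsigma v w : differentiable (loc v w) x0.
  have dB : is_diff x0 B (Diff B x0).
    by apply: is_diff_Diff; have [+ _] := sB 1; apply; rewrite -overlap_self.
  have dBvw := is_diff_compl (eval_at R^o w)
    (is_diff_compl (eval_at (dual E) v) dB).
  suff BEvw : {near x0, eval_at R^o w \o (eval_at (dual E) v \o B) =1 loc v w}.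
    by have [] := near_eq_is_diff BEvw dBvw.
  apply: filterS (near_overlap hN qcc) => x xc /=.
  by rewrite /loc BE// -overlap_self.
(* The canonical pairing is constant in the chart, and the rest depends on the base coordinate
   alone. *)
have key (S T X : E * dual E) :
    'd (fun y => local2 (twisted_form sigma) c y S T : R^o) z0 X =
    'd (loc S.1 T.1) x0 X.1.
  have dfst := is_diff_clinear (fst_clinear E (dual E)) z0.
  have dloc := is_diff_comp dfst (differentiableP (dsigma S.1 T.1)).
  have dST := is_diffD (is_diff_cst (S.2 T.1 - T.2 S.1 : R^o) z0) dloc.
  have tE : {near z0, cst (S.2 T.1 - T.2 S.1 : R^o)
      + loc S.1 T.1 \o fst_clinear E (dual E)
      =1 (fun y => local2 (twisted_form sigma) c y S T : R^o)}.
    apply: filterS (near_overlap_fst hN zc) => y yc.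
    by rewrite (local2_twisted_form hN).
  have [_ ->] := near_eq_is_diff tE dST.
  by rewrite add0r.
by congr (_ - _ + _); exact: key.
Qed.

Lemma twisted_form_nondegenerate (z : cotangent N) (W : tangent z) :
  is_2form sigma -> W != 0 -> exists V : tangent z, twisted_form sigma V W != 0.
Proof.
case: W => u eta [_ sigmaC] W0.
pose q := projT1 z; pose c := chart_at q.
have qc : chart_dom c q := chart_at_dom hN q.
have [B [_ BE]] := sigmaC c.
(* Bilinearity of [sigma] at [q] is available through its local representative; it makes the [sigma]
   term vanish in both cases below. *)
have sigmaE v w : sigma (q := q) v w = B (chart c q) v w.
  by rewrite -BE ?local2_chart_at//; exists q.
have [u0|u0] := eqVneq u 0.
  have [v ev] : exists v : E, eta v != 0.
    apply: contrapT => ev; move/eqP: W0; apply; rewrite u0; congr (_, _).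
    apply: clinearP => v; apply/eqP/negPn/negP => etav; apply: ev; by exists v.
  exists ((v, 0) : E * dual E).
  rewrite (twisted_formE hN)/= sigmaE u0 linear0.
  change (0 - eta v + 0 != 0).
  by rewrite sub0r addr0 oppr_eq0.
have [theta tu] := dual_separates u0.
exists ((0, theta) : E * dual E).
rewrite (twisted_formE hN)/= sigmaE !linear0.
change (theta u + 0 + 0 != 0).
by rewrite !addr0.
Qed.

End Twisted.

Theorem corollaryA6 (R : realType) (E : completeNormedModType R)
    (N : charted_space E) (hN : smooth_manifold N)
    (sigma : form2 N) (hsigma : closed_2form sigma) :
  weak_symplectic (twisted_form sigma).
Proof.
have [sigma2 dsigma0] := hsigma.
split; last by move=> z W; exact: twisted_form_nondegenerate.
split; first exact: twisted_form_is_2form.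
by move=> z U V W; rewrite twisted_form_ext2// dsigma0.
Qed.
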